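(* Let $(V,E,w)$ be a finite undirected graph with $V=\{1,\dots,n\}$ and nonnegative edge weights $w_{ij}$, and let $|\partial S|=\sum_{i\in S,\,j\in V\setminus S}w_{ij}$. Then $$\min_{S\ne\varnothing,V}|\partial S|=\min_{\vec x\ne\vec 0:\ \min_ix_i+\max_ix_i=0}\frac{\sum_{ij\in E}w_{ij}|x_i-x_j|}{2\|\vec x\|_\infty}=\tilde\lambda_2,\qquad \max_{S\ne\varnothing,V}|\partial S|=\max_{\vec x\ne\vec0}\frac{\sum_{ij\in E}w_{ij}|x_i-x_j|}{2\|\vec x\|_\infty}=\tilde\lambda_{\max},$$ where $\tilde\lambda_2$ and $\tilde\lambda_{\max}$ are respectively the second (smallest nontrivial) eigenvalue and the largest eigenvalue of the nonlinear eigenvalue problem $\vec 0\in\nabla\sum_{ij\in E}w_{ij}|x_i-x_j|-\lambda\nabla(2\|\vec x\|_\infty)$.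
   Context: $\nabla$ is the convex subdifferential; $\lambda$ is an eigenvalue with eigenvector $\vec x\ne\vec0$ if the inclusion holds. The trivial eigenvalue is $0$ (eigenvectors: nonzero constant vectors); the smallest nontrivial eigenvalue $\tilde\lambda_2$ means the smallest eigenvalue admitting a non-constant eigenvector. *)

(* Defs.v *)
From HB Require Import structures.
From mathcomp Require Import all_boot all_order all_algebra.
From mathcomp Require Import all_classical all_reals all_analysis.

Set Implicit Arguments.
Unset Strict Implicit.
Unset Printing Implicit Defensive.

Import Order.TTheory GRing.Theory Num.Theory.
Import numFieldNormedType.Exports.

Local Open Scope classical_set_scope.
Local Open Scope ring_scope.

Definition is_min (R : realType) (A : set R) (m : R) : Prop :=
  A m /\ lbound A m.

Definition is_max (R : realType) (A : set R) (m : R) : Prop :=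
  A m /\ ubound A m.

(* [weight_nonedge] is the convention under which sums of weights over all
   pairs of vertices, as in [cut], only see edges. Loops are allowed: they
   contribute neither to [cut] nor to [total_variation]. *)
Record weighted_graph (R : realType) (n : nat) := WeightedGraph {
  edge : rel 'I_n;
  weight : 'I_n -> 'I_n -> R;
  edge_sym : symmetric edge;
  weight_sym : forall i j, weight i j = weight j i;
  weight_ge0 : forall i j, 0 <= weight i j;
  weight_nonedge : forall i j, ~~ edge i j -> weight i j = 0 }.

Section WeightedGraph.
Variables (R : realType) (n : nat) (G : weighted_graph R n).

Definition cut (S : {set 'I_n}) : R :=
  \sum_(i in S) \sum_(j in ~: S) weight G i j.

(* The guard [i <= j] makes each undirected edge count once. *)
Definition total_variation (x : 'rV[R]_n) : R :=
  \sum_(i < n) \sum_(j < n | (i <= j)%N && edge G i j)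
    weight G i j * `|x 0 i - x 0 j|.

(* On matrices [`|x|] is the maximum of the absolute values of the entries,
   so on row vectors it is the sup norm. *)
Definition sup_norm2 (x : 'rV[R]_n) : R := 2 * `|x|.

Definition rayleigh (x : 'rV[R]_n) : R := total_variation x / sup_norm2 x.

Definition subdifferential (f : 'rV[R]_n -> R) (x : 'rV[R]_n) : set 'rV[R]_n :=
  [set u : 'rV[R]_n | forall y : 'rV[R]_n,
     f x + \sum_(i < n) u 0 i * (y 0 i - x 0 i) <= f y].

Definition eigenpair (lambda : R) (x : 'rV[R]_n) : Prop :=
  x != 0 /\
  [set u - lambda *: v | u in subdifferential total_variation x
                       & v in subdifferential sup_norm2 x] 0.

Definition eigenvalues : set R :=
  [set lambda | exists x, eigenpair lambda x].

Definition nontrivial_eigenvalues : set R :=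
  [set lambda | exists x, eigenpair lambda x /\ ~ (exists c, x = const_mx c)].

Definition balanced (x : 'rV[R]_n) : Prop :=
  exists a b, [/\ is_min (range (x 0)) a, is_max (range (x 0)) b & a + b = 0].

Definition cut_values : set R :=
  [set cut S | S in [set S : {set 'I_n} | S <> finset.set0 /\ S <> finset.setT]].

End WeightedGraph.

(* Main.v *)
Require Import Defs.
From mathcomp Require Import all_boot all_order all_algebra.
From mathcomp Require Import all_classical all_reals all_analysis.
From mathcomp Require Import ring lra.

Import Order.TTheory GRing.Theory Num.Theory.
Import numFieldNormedType.Exports.

Local Open Scope classical_set_scope.
Local Open Scope ring_scope.

(* Write [TV] for the total variation. The coarea formula makes [TV x] a
   combination of nonempty proper cuts with nonnegative coefficients of total
   mass [max x - min x]; this mass is at most [2 |x|], with equality when [x] is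
   balanced, which gives both bounds on Rayleigh quotients. By Euler's identity
   every eigenvalue is the Rayleigh quotient of its eigenvector, and a
   nonconstant eigenvector of a nonzero eigenvalue has [max x - min x = 2 |x|].
   Conversely every cut is an eigenvalue: at the vector equal to [1] on [S] and
   [-1] off [S], choosing the zero subgradient on all uncut edges yields a
   subgradient of [TV] having the signs of that vector and l1 norm
   [2 * cut S], hence lying in [cut S] times the subdifferential of [2 |.|]. *)

(** * The sup norm through entries, and sums over unordered pairs *)

Lemma mx_norm_le (R : realType) (n : nat) (x : 'rV[R]_n) (c : R) :
  0 <= c -> (forall i, `|x 0 i| <= c) -> `|x| <= c.
Proof.
move=> c0 xc; rewrite [leLHS]/Num.norm /= mx_normrE.
by apply/bigmax_leP; split => // -[i j] _ /=; rewrite (ord1 i).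
Qed.

Lemma le_mx_norm (R : realType) (n : nat) (x : 'rV[R]_n) (i : 'I_n) :
  `|x 0 i| <= `|x|.
Proof.
rewrite [leRHS]/Num.norm /= mx_normrE.
by apply/bigmax_geP; right; exists (0, i).
Qed.

(** Swapping indices matches the pairs above the diagonal with those below it. This turns sums
    counting each edge once into unrestricted double sums. *)
Lemma sum_sym_scale2 (R : realType) (n : nat) (F : 'I_n -> 'I_n -> R) :
  (forall i j, F i j = F j i) -> (forall i, F i i = 0) ->
  (\sum_(i < n) \sum_(j < n | (i <= j)%N) F i j) * 2 = \sum_(i < n) \sum_j F i j.
Proof.
move=> Fsym Fdiag.
have -> : \sum_(i < n) \sum_j F i j =
    \sum_(i < n) \sum_(j < n | (i <= j)%N) F i j + \sum_(i < n) \sum_(j < n | ~~ (i <= j)%N) F i j.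
  by rewrite -big_split; apply: eq_bigr => i _; rewrite [LHS](bigID (fun j : 'I_n => (i <= j)%N)).
suff -> : \sum_(i < n) \sum_(j < n | ~~ (i <= j)%N) F i j = \sum_(i < n) \sum_(j < n | (i <= j)%N) F i j.
  by ring.
rewrite (exchange_big_dep predT) //=; apply: eq_bigr => i _.
rewrite [RHS](bigD1 i) //= Fdiag add0r.
apply: eq_big => [j|j _]; last exact: Fsym.
by rewrite -ltnNge ltn_neqAle andbC eq_sym.
Qed.

Section WeightedGraph.
Context {R : realType} {n : nat} (G : weighted_graph R n).

Local Notation w := (weight G).
Local Notation TV := (Defs.total_variation G).

(** * Total variation and cuts as double sums; the sign vector of a vertex set *)

Definition indic (S : {set 'I_n}) (i : 'I_n) : R := (i \in S)%:R.

Definition cut_vector (S : {set 'I_n}) : 'rV[R]_n :=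
  \row_i (if i \in S then 1 else -1).

Lemma total_variation_scale2 (x : 'rV[R]_n) :
  TV x * 2 = \sum_i \sum_j w i j * `|x 0 i - x 0 j|.
Proof.
rewrite -sum_sym_scale2; last 2 first.
- by move=> i j; rewrite weight_sym distrC.
- by move=> i; rewrite subrr normr0 mulr0.
congr (_ * _); apply: eq_bigr => i _; rewrite [RHS](bigID (edge G i)) /=.
rewrite [X in _ + X]big1 ?addr0 // => j /andP[_ ne].
by rewrite weight_nonedge ?mul0r.
Qed.

Lemma total_variation_ge0 (x : 'rV[R]_n) : 0 <= TV x.
Proof.
by do 2![apply: sumr_ge0 => ? _]; rewrite mulr_ge0 ?weight_ge0 ?normr_ge0.
Qed.

Lemma cut_ge0 (S : {set 'I_n}) : 0 <= Defs.cut G S.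
Proof. by do 2![apply: sumr_ge0 => ? _]; exact: weight_ge0. Qed.

(** The double sum meets each separated pair twice, once from each side: [cutE] and [cutE'] are the
    two orientations of the cut. *)
Lemma cut_scale2 (S : {set 'I_n}) :
  Defs.cut G S * 2 = \sum_i \sum_j w i j * `|indic S i - indic S j|.
Proof.
have cutE : Defs.cut G S = \sum_i \sum_j w i j * (indic S i * (1 - indic S j)).
  rewrite /Defs.cut big_mkcond; apply: eq_bigr => i _; rewrite /indic.
  case: (i \in S); last by rewrite big1 // => j _; rewrite mul0r mulr0.
  rewrite big_mkcond; apply: eq_bigr => j _; rewrite inE.
  by case: (j \in S); rewrite /= ?subrr ?subr0 ?mulr0 ?mulr1.
have cutE' : Defs.cut G S = \sum_i \sum_j w i j * (indic S j * (1 - indic S i)).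
  rewrite cutE exchange_big; apply: eq_bigr => i _; apply: eq_bigr => j _.
  by rewrite weight_sym.
rewrite mulr2n mulrDr mulr1 {1}cutE cutE' -big_split; apply: eq_bigr => i _.
rewrite -big_split; apply: eq_bigr => j _ /=.
rewrite -mulrDr /indic; congr (_ * _).
by case: (i \in S); case: (j \in S);
  rewrite /= ?subrr ?subr0 ?sub0r ?normrN ?normr1 ?normr0; ring.
Qed.

Lemma total_variation_cut_vector (S : {set 'I_n}) :
  TV (cut_vector S) = 2 * Defs.cut G S.
Proof.
apply: (mulIf (_ : 2 != 0 :> R)); first by rewrite pnatr_eq0.
rewrite total_variation_scale2 -mulrA cut_scale2 mulr_sumr.
apply: eq_bigr => i _; rewrite mulr_sumr; apply: eq_bigr => j _.
rewrite !mxE mulrCA -[2 in RHS]ger0_norm // -normrM; congr (_ * `|_|).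
by rewrite /indic; case: (i \in S); case: (j \in S); rewrite /=; ring.
Qed.

Lemma mx_norm_cut_vector (S : {set 'I_n}) : (0 < n)%N -> `|cut_vector S| = 1.
Proof.
move=> n0.
have xE i : `|cut_vector S 0 i| = 1.
  by rewrite mxE; case: ifP; rewrite ?normrN normr1.
apply/eqP; rewrite eq_le mx_norm_le //=; last by move=> i; rewrite xE.
by rewrite -(xE (Ordinal n0)) le_mx_norm.
Qed.

Lemma rayleigh_cut_vector (S : {set 'I_n}) :
  (0 < n)%N -> rayleigh G (cut_vector S) = Defs.cut G S.
Proof.
move=> n0; rewrite /rayleigh /sup_norm2 mx_norm_cut_vector //.
by rewrite total_variation_cut_vector mulr1 mulrAC divff ?mul1r ?pnatr_eq0.
Qed.

(* Discrete coarea formula; the [S k] are the superlevel sets of [x] at its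
   successive sorted values, and [d k] the gaps between these values. *)
Lemma coarea (x : 'rV[R]_n) (a b : 'I_n) :
  (forall i, x 0 a <= x 0 i) -> (forall i, x 0 i <= x 0 b) ->
  exists (d : nat -> R) (S : nat -> {set 'I_n}),
    [/\ forall k, (k < n.-1)%N -> 0 <= d k,
        forall k, (k < n.-1)%N -> d k != 0 -> S k <> finset.set0 /\ S k <> finset.setT,
        \sum_(0 <= k < n.-1) d k = x 0 b - x 0 a
      & TV x = \sum_(0 <= k < n.-1) d k * Defs.cut G (S k)].
Proof.
move=> xa xb.
have n0 : (0 < n)%N by exact: leq_ltn_trans (ltn_ord a).
pose s := sort <=%O (codom (x 0)).
have ss : sorted <=%O s by exact: sort_le_sorted.
have sz : size s = n by rewrite size_sort size_codom card_ord.
have s_le i j : (i <= j)%N -> (j < n)%N -> s`_i <= s`_j.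
  by move=> ij jn; apply: le_sorted_leq_nth => //; rewrite inE sz // (leq_ltn_trans ij).
have s_x i : exists2 p, (p < n)%N & s`_p = x 0 i.
  have : x 0 i \in s by rewrite mem_sort codom_f.
  by move=> /(nthP 0)[p]; rewrite sz => pn sp; exists p.
have x_s p : (p < n)%N -> exists i, s`_p = x 0 i.
  move=> pn; have : s`_p \in s by rewrite mem_nth ?sz.
  by rewrite mem_sort => /codomP.
have s0 : s`_0 = x 0 a.
  apply: le_anti; have [i si] := x_s _ n0; rewrite {2}si xa andbT.
  by have [p pn <-] := s_x a; apply: s_le.
have sl : s`_n.-1 = x 0 b.
  have nn : (n.-1 < n)%N by rewrite prednK.
  apply: le_anti; have [i si] := x_s _ nn; rewrite {1}si xb /=.
  by have [p pn <-] := s_x b; apply: s_le => //; rewrite -ltnS prednK.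
(* The [n] sorted values, kept with repetitions, leave [n.-1] gaps, some possibly zero. *)
pose d k := s`_k.+1 - s`_k.
pose S k := [set i | s`_k < x 0 i]%SET.
have d0 k : (k < n.-1)%N -> 0 <= d k.
  by move=> kn; rewrite subr_ge0; apply: s_le => //; rewrite -ltn_predRL.
have layer i : x 0 i = s`_0 + \sum_(0 <= k < n.-1) d k * indic (S k) i.
  have [p pn xp] := s_x i.
  have pn1 : (p <= n.-1)%N by rewrite -ltnS prednK.
  (* Split at the position [p] of [x 0 i]. From [p] on, the level sets miss [i]; before [p], a level
     set missing [i] forces equal values and hence a zero gap. The rest telescopes. *)
  rewrite (big_cat_nat (leq0n p) pn1) /= [X in _ + (_ + X)]big_nat_cond.
  rewrite [X in _ + (_ + X)]big1 ?addr0; last first.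
    move=> k /andP[/andP[pk kn] _]; rewrite /indic inE -xp ltNge s_le ?mulr0 //.
    by rewrite (leq_trans kn) // leq_pred.
  rewrite (eq_big_nat _ _ (F2 := d)); first by rewrite telescope_sumr // addrC subrK xp.
  move=> k /andP[_ kp]; rewrite /indic inE -xp.
  case: ltP => [_|h]; first by rewrite mulr1.
  rewrite mulr0 /d; apply/eqP; rewrite eq_sym subr_eq0 eq_le.
  by rewrite (s_le k k.+1) ?(leq_ltn_trans kp) // andbT (le_trans _ h) // s_le.
have dist i j : `|x 0 i - x 0 j| =
    \sum_(0 <= k < n.-1) d k * `|indic (S k) i - indic (S k) j|.
  (* Level sets are nested, so once [x 0 j <= x 0 i] all indicator differences are nonnegative and
     the distance splits without cancellation. *)
  wlog xij : i j / x 0 j <= x 0 i => [hw|].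
    have [/hw//|/ltW/hw] := leP (x 0 j) (x 0 i).
    by rewrite distrC => ->; apply: eq_bigr => k _; rewrite distrC.
  rewrite ger0_norm ?subr_ge0 // (layer i) (layer j) opprD addrACA subrr add0r.
  rewrite -sumrB; apply: eq_bigr => k _; rewrite -mulrBr ger0_norm // subr_ge0.
  rewrite /indic !inE; case: (ltP s`_k (x 0 j)) => [h|_]; last exact: ler0n.
  by rewrite (lt_le_trans h xij).
exists d, S; split => //.
- move=> k kn dk.
  have sk : s`_k < s`_k.+1.
    by rewrite lt_neqAle -subr_ge0 -/(d k) d0 // andbT -subr_eq0 -oppr_eq0 opprB.
  have kn1 : (k.+1 < n)%N by rewrite -ltn_predRL.
  (* A positive gap puts the maximizer [b] in the level set; the minimizer [a] lies in none. *)
  split=> /setP.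
    move/(_ b); rewrite !inE -sl => /negbT/negP; apply.
    by rewrite (lt_le_trans sk) // s_le // ?prednK.
  by move/(_ a); rewrite !inE -s0 ltNge s_le // ltnW.
- by rewrite telescope_sumr // sl s0.
- apply: (mulIf (_ : 2 != 0 :> R)); first by rewrite pnatr_eq0.
  rewrite total_variation_scale2 mulr_suml.
  under [RHS]eq_bigr => k _ do rewrite -mulrA cut_scale2 mulr_sumr.
  rewrite [RHS]exchange_big; apply: eq_bigr => i _ /=.
  under [RHS]eq_bigr => k _ do rewrite mulr_sumr.
  rewrite [RHS]exchange_big; apply: eq_bigr => j _ /=.
  by rewrite dist mulr_sumr; apply: eq_bigr => k _; rewrite mulrCA.
Qed.

(** * Bounds on total variation by extreme cuts *)

Lemma total_variation_ge (x : 'rV[R]_n) (a b : 'I_n) (m : R) :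
  (forall i, x 0 a <= x 0 i) -> (forall i, x 0 i <= x 0 b) ->
  lbound (cut_values G) m -> (x 0 b - x 0 a) * m <= TV x.
Proof.
move=> xa xb mP; have [d [S [d0 Sp <- ->]]] := coarea _ _ _ xa xb.
rewrite mulr_suml; apply: ler_sum_nat => k /andP[_ kn].
(* A level set at a zero gap may be empty, and then [mP] does not bound its cut. *)
have [->|dk] := eqVneq (d k) 0; first by rewrite !mul0r.
by rewrite ler_wpM2l ?d0 //; apply: mP; exists (S k) => //; exact: Sp.
Qed.

Lemma total_variation_le (x : 'rV[R]_n) (a b : 'I_n) (m : R) :
  (forall i, x 0 a <= x 0 i) -> (forall i, x 0 i <= x 0 b) ->
  ubound (cut_values G) m -> TV x <= (x 0 b - x 0 a) * m.
Proof.
move=> xa xb mP; have [d [S [d0 Sp <- ->]]] := coarea _ _ _ xa xb.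
rewrite mulr_suml; apply: ler_sum_nat => k /andP[_ kn].
have [->|dk] := eqVneq (d k) 0; first by rewrite !mul0r.
by rewrite ler_wpM2l ?d0 //; apply: mP; exists (S k) => //; exact: Sp.
Qed.

(** * Subgradients, homogeneity and eigenpairs *)

Lemma sum_mulB (u x y : 'rV[R]_n) :
  \sum_i u 0 i * (y 0 i - x 0 i) = \sum_i u 0 i * y 0 i - \sum_i u 0 i * x 0 i.
Proof. by rewrite -sumrB; apply: eq_bigr => i _; rewrite mulrBr. Qed.

(** Testing the subgradient inequality at [0] and at [2 *: x] bounds the pairing from below and from
    above. *)
Lemma subdifferential_euler (f : 'rV[R]_n -> R) (x u : 'rV[R]_n) :
  f 0 = 0 -> f (2 *: x) = 2 * f x -> subdifferential f x u ->
  \sum_i u 0 i * x 0 i = f x.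
Proof.
move=> f0 f2 fu.
have u0 : \sum_i u 0 i * (0 : 'rV[R]_n) 0 i = 0.
  by rewrite big1 // => i _; rewrite mxE mulr0.
have u2 : \sum_i u 0 i * (2 *: x) 0 i = 2 * \sum_i u 0 i * x 0 i.
  by rewrite mulr_sumr; apply: eq_bigr => i _; rewrite mxE mulrCA.
have := fu 0; have := fu (2 *: x).
by rewrite !sum_mulB f0 f2 u0 u2 => h1 h2; lra.
Qed.

Lemma subdifferentialI (f : 'rV[R]_n -> R) (x u : 'rV[R]_n) :
  \sum_i u 0 i * x 0 i = f x -> (forall y : 'rV[R]_n, \sum_i u 0 i * y 0 i <= f y) ->
  subdifferential f x u.
Proof. by move=> ux uy y; rewrite sum_mulB ux addrC subrK. Qed.

Lemma total_variationZ (c : R) (x : 'rV[R]_n) : TV (c *: x) = `|c| * TV x.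
Proof.
rewrite /Defs.total_variation mulr_sumr; apply: eq_bigr => i _.
rewrite mulr_sumr; apply: eq_bigr => j _.
by rewrite !mxE -mulrBr normrM mulrCA.
Qed.

Lemma total_variationD_const (c : R) (x : 'rV[R]_n) : TV (x + const_mx c) = TV x.
Proof.
apply: eq_bigr => i _; apply: eq_bigr => j _.
by rewrite !mxE opprD addrACA subrr addr0.
Qed.

Lemma sup_norm2Z (c : R) (x : 'rV[R]_n) : sup_norm2 (c *: x) = `|c| * sup_norm2 x.
Proof. by rewrite /sup_norm2 normrZ mulrCA. Qed.

Lemma sup_norm2_gt0 (x : 'rV[R]_n) : x != 0 -> 0 < sup_norm2 x.
Proof. by move=> x0; rewrite mulr_gt0 // normr_gt0. Qed.

(** Pair [u = lambda *: v] with [x] and apply Euler's identity to both sides. *)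
Lemma eigenpair_total_variation (lambda : R) (x : 'rV[R]_n) :
  eigenpair G lambda x -> TV x = lambda * sup_norm2 x.
Proof.
move=> [x0 [u ux [v vx /eqP]]]; rewrite subr_eq0 => /eqP uv.
have TV0 : TV 0 = 0 by rewrite -(scale0r 0) total_variationZ normr0 mul0r.
have N0 : sup_norm2 (0 : 'rV[R]_n) = 0 by rewrite /sup_norm2 normr0 mulr0.
rewrite -(@subdifferential_euler TV x u) //; last by rewrite total_variationZ ger0_norm.
rewrite -(@subdifferential_euler (@sup_norm2 R n) x v) //; last by rewrite sup_norm2Z ger0_norm.
by rewrite mulr_sumr; apply: eq_bigr => i _; rewrite uv mxE mulrA.
Qed.

Lemma eigenpair_rayleigh (lambda : R) (x : 'rV[R]_n) :
  eigenpair G lambda x -> lambda = rayleigh G x.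
Proof.
move=> lx; rewrite /rayleigh (eigenpair_total_variation _ _ lx) mulfK //.
by rewrite gt_eqF // sup_norm2_gt0 //; case: lx.
Qed.

(* Subgradients of [TV] sum to zero because [TV] ignores constants; being
   [lambda] times a subgradient of the norm, this says that the norm does not
   decrease at [x] along constant vectors. *)
Lemma eigenpair_norm_le (lambda c : R) (x : 'rV[R]_n) :
  eigenpair G lambda x -> lambda != 0 -> `|x| <= `|x + const_mx c|.
Proof.
move=> [x0 [u ux [v vx /eqP]]]; rewrite subr_eq0 => /eqP uv l0.
have shift (z : 'rV[R]_n) e :
    \sum_i z 0 i * ((x + const_mx e) 0 i - x 0 i) = (\sum_i z 0 i) * e.
  by rewrite mulr_suml; apply: eq_bigr => i _; rewrite !mxE addrAC subrr add0r.
have u0 : \sum_i u 0 i = 0.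
  have := ux (x + const_mx 1); have := ux (x + const_mx (-1)).
  by rewrite !shift !total_variationD_const => h1 h2; lra.
have v0 : \sum_i v 0 i = 0.
  apply: (mulfI l0); rewrite mulr0 -[RHS]u0 mulr_sumr.
  by apply: eq_bigr => i _; rewrite uv mxE.
have := vx (x + const_mx c); rewrite shift v0 mul0r addr0.
by rewrite ler_pM2l.
Qed.

(** * Every cut is an eigenvalue *)

(** At [cut_vector S], the factor [indic S i - indic S j] is the sign of the difference of the
    entries [i] and [j]. *)
Definition cut_subgradient (S : {set 'I_n}) : 'rV[R]_n :=
  \row_i \sum_j w i j * (indic S i - indic S j).

(** Summation by parts: exchanging [i] and [j] flips the sign of the indicator difference. *)
Lemma cut_subgradient_dot (S : {set 'I_n}) (y : 'rV[R]_n) :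
  (\sum_i cut_subgradient S 0 i * y 0 i) * 2 =
  \sum_i \sum_j w i j * ((indic S i - indic S j) * (y 0 i - y 0 j)).
Proof.
have E : \sum_i cut_subgradient S 0 i * y 0 i =
    \sum_i \sum_j w i j * ((indic S i - indic S j) * y 0 i).
  apply: eq_bigr => i _; rewrite mxE mulr_suml.
  by apply: eq_bigr => j _; rewrite mulrA.
have E' : \sum_i cut_subgradient S 0 i * y 0 i =
    \sum_i \sum_j w i j * ((indic S i - indic S j) * (- y 0 j)).
  rewrite E exchange_big; apply: eq_bigr => i _; apply: eq_bigr => j _.
  by rewrite weight_sym mulrN -mulNr opprB.
rewrite mulr2n mulrDr mulr1 {1}E E' -big_split; apply: eq_bigr => i _.
by rewrite -big_split; apply: eq_bigr => j _ /=; ring.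
Qed.

Lemma cut_subgradientP (S : {set 'I_n}) :
  subdifferential TV (cut_vector S) (cut_subgradient S).
Proof.
apply: subdifferentialI => [|y].
  apply: (mulIf (_ : 2 != 0 :> R)); first by rewrite pnatr_eq0.
  rewrite cut_subgradient_dot total_variation_scale2.
  apply: eq_bigr => i _; apply: eq_bigr => j _; congr (_ * _).
  rewrite !mxE /indic; case: (i \in S); case: (j \in S) => /=.
  - by rewrite !subrr normr0 mul0r.
  - by rewrite ger0_norm; lra.
  - by rewrite ler0_norm; lra.
  - by rewrite !subrr normr0 mul0r.
(* The bound holds pair by pair, since indicator differences lie in [[-1, 1]]. *)
rewrite -(ler_pM2r (ltr0Sn R 1)) cut_subgradient_dot total_variation_scale2.
apply: ler_sum => i _; apply: ler_sum => j _; rewrite ler_wpM2l ?weight_ge0 //.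
rewrite (le_trans (ler_norm _)) // normrM ler_piMl //.
rewrite /indic; case: (i \in S); case: (j \in S);
  by rewrite /= ?subrr ?subr0 ?sub0r ?normrN ?normr1 ?normr0.
Qed.

(** Within row [i] all terms share one sign, decided by whether [i] is in [S], so nothing cancels.
    The l1 norm matters as the dual of the sup norm. *)
Lemma cut_subgradient_norm (S : {set 'I_n}) :
  \sum_i `|cut_subgradient S 0 i| = 2 * Defs.cut G S.
Proof.
rewrite mulrC cut_scale2; apply: eq_bigr => i _; rewrite mxE.
transitivity `|\sum_j w i j * `|indic S i - indic S j| |; last first.
  by apply: ger0_norm; apply: sumr_ge0 => j _; rewrite mulr_ge0 ?weight_ge0.
case: (boolP (i \in S)) => iS; last rewrite -normrN -sumrN.
  congr (`|_|); apply: eq_bigr => j _; rewrite ger0_norm // /indic iS.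
  by case: (j \in S); rewrite /= ?subrr ?subr0.
congr (`|_|); apply: eq_bigr => j _; rewrite -mulrN ler0_norm // /indic (negbTE iS).
by rewrite sub0r oppr_le0.
Qed.

Lemma eigenpair_cut (S : {set 'I_n}) :
  (0 < n)%N -> eigenpair G (Defs.cut G S) (cut_vector S).
Proof.
move=> n0; have norm1 := mx_norm_cut_vector S n0.
split; first by rewrite -normr_eq0 norm1 oner_neq0.
have [c0|c0] := eqVneq (Defs.cut G S) 0.
  exists 0.
    apply: subdifferentialI => [|y].
      by rewrite total_variation_cut_vector c0 mulr0 big1 // => i _; rewrite mxE mul0r.
    by rewrite big1 ?total_variation_ge0 // => i _; rewrite mxE mul0r.
  (* With a zero cut, [0] is a subgradient of [TV] and any subgradient of the norm will do; the one
     chosen is a signed multiple of the coordinate vector at [o], where [|x|] is attained. *)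
  pose o := Ordinal n0.
  have dot (y : 'rV[R]_n) : \sum_i (2 * cut_vector S 0 o *: delta_mx 0 o : 'rV[R]_n) 0 i * y 0 i =
      2 * cut_vector S 0 o * y 0 o.
    rewrite (bigD1 o) //= big1 => [|i /negbTE io]; last by rewrite !mxE io /= mulr0 mul0r.
    by rewrite !mxE !eqxx mulr1 addr0.
  have on : `|cut_vector S 0 o| = 1.
    by rewrite mxE; case: ifP; rewrite ?normrN normr1.
  exists (2 * cut_vector S 0 o *: delta_mx 0 o); last by rewrite c0 scale0r subr0.
  apply: subdifferentialI => [|y]; rewrite dot /sup_norm2.
    by rewrite norm1 -mulrA -expr2 -real_normK ?num_real // on expr1n.
  rewrite -mulrA ler_pM2l // (le_trans (ler_norm _)) // normrM on mul1r.
  exact: le_mx_norm.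
exists (cut_subgradient S); first exact: cut_subgradientP.
exists ((Defs.cut G S)^-1 *: cut_subgradient S); last by rewrite scalerA divff // scale1r subrr.
have dot (y : 'rV[R]_n) : \sum_i ((Defs.cut G S)^-1 *: cut_subgradient S) 0 i * y 0 i =
    (Defs.cut G S)^-1 * \sum_i cut_subgradient S 0 i * y 0 i.
  by rewrite mulr_sumr; apply: eq_bigr => i _; rewrite mxE mulrA.
have cpos : 0 < Defs.cut G S by rewrite lt_neqAle eq_sym c0 cut_ge0.
apply: subdifferentialI => [|y]; rewrite dot /sup_norm2.
  rewrite (@subdifferential_euler TV (cut_vector S)); last exact: cut_subgradientP.
  - by rewrite total_variation_cut_vector norm1 mulr1 mulrCA mulVf // mulr1.
  - by rewrite -(scale0r 0) total_variationZ normr0 mul0r.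
  - by rewrite total_variationZ ger0_norm.
(* Hölder's inequality between the l1 norm of the subgradient and the sup norm of [y]. *)
rewrite mulrC ler_pdivrMr // mulrAC -cut_subgradient_norm mulr_suml.
apply: ler_sum => i _; rewrite (le_trans (ler_norm _)) // normrM.
by rewrite ler_wpM2l // le_mx_norm.
Qed.

(** * Bounds on Rayleigh quotients and eigenvalues *)

Lemma ex_row_min (x : 'rV[R]_n) : (0 < n)%N -> exists a, forall i, x 0 a <= x 0 i.
Proof.
move=> n0; case: (arg_minP (x 0) (isT : predT (Ordinal n0))) => a _ xa.
by exists a => i; exact: xa.
Qed.

Lemma ex_row_max (x : 'rV[R]_n) : (0 < n)%N -> exists b, forall i, x 0 i <= x 0 b.
Proof.
move=> n0; case: (arg_maxP (x 0) (isT : predT (Ordinal n0))) => b _ xb.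
by exists b => i; exact: xb.
Qed.

(** The oscillation hypothesis is the property shared by balanced vectors and nonconstant
    eigenvectors of nonzero eigenvalues, so one bound serves both minima. *)
Lemma rayleigh_ge (x : 'rV[R]_n) (a b : 'I_n) (m : R) :
  0 <= m -> x != 0 ->
  (forall i, x 0 a <= x 0 i) -> (forall i, x 0 i <= x 0 b) ->
  sup_norm2 x <= x 0 b - x 0 a ->
  lbound (cut_values G) m -> m <= rayleigh G x.
Proof.
move=> m0 x0 xa xb osc mP; rewrite /rayleigh ler_pdivlMr ?sup_norm2_gt0 //.
by rewrite (le_trans _ (total_variation_ge _ _ _ _ xa xb mP)) // mulrC ler_wpM2r.
Qed.

Lemma rayleigh_le (x : 'rV[R]_n) (m : R) :
  (0 < n)%N -> 0 <= m -> x != 0 ->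
  ubound (cut_values G) m -> rayleigh G x <= m.
Proof.
move=> n0 m0 x0 mP; rewrite /rayleigh ler_pdivrMr ?sup_norm2_gt0 //.
have [a xa] := ex_row_min x n0; have [b xb] := ex_row_max x n0.
rewrite (le_trans (total_variation_le _ _ _ _ xa xb mP)) // mulrC ler_wpM2l //.
have := le_mx_norm _ _ x a; have := le_mx_norm _ _ x b.
by rewrite !ler_norml /sup_norm2 => /andP[_ h1] /andP[h2 _]; lra.
Qed.

Lemma nontrivial_eigenvalue_ge (lambda m : R) (x : 'rV[R]_n) :
  (0 < n)%N -> 0 <= m -> eigenpair G lambda x -> ~ (exists c, x = const_mx c) ->
  lbound (cut_values G) m -> m <= lambda.
Proof.
move=> n0 m0 lx xc mP.
have [a xa] := ex_row_min x n0; have [b xb] := ex_row_max x n0.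
(* For eigenvalue [0] the total variation vanishes while the oscillation is positive, which forces
   [m <= 0]. *)
have [l0|l0] := eqVneq lambda 0.
  have ab : x 0 a < x 0 b.
    rewrite ltNge; apply/negP => ba; apply: xc; exists (x 0 a).
    apply/rowP => i; rewrite mxE; apply: le_anti; rewrite xa andbT.
    exact: le_trans (xb i) ba.
  have := total_variation_ge _ _ _ _ xa xb mP.
  rewrite (eigenpair_total_variation _ _ lx) l0 mul0r.
  by rewrite pmulr_rle0 ?subr_gt0.
rewrite (eigenpair_rayleigh _ _ lx).
apply: rayleigh_ge => //; first by case: lx.
(* Shifting by the midrange brings the norm down to at most half the oscillation; as no constant
   shift lowers the norm, [|x|] obeys the same bound. *)
have := eigenpair_norm_le _ (- ((x 0 a + x 0 b) / 2)) _ lx l0.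
have : `|x + const_mx (- ((x 0 a + x 0 b) / 2))| <= (x 0 b - x 0 a) / 2.
  apply: mx_norm_le => [|i]; first by have := xa b; lra.
  by rewrite !mxE ler_norml; have := xa i; have := xb i; move=> ? ?; apply/andP; split; lra.
by rewrite /sup_norm2 => h1 h2; lra.
Qed.

Lemma balanced_sup_norm2 (x : 'rV[R]_n) : balanced x ->
  exists a b, [/\ forall i, x 0 a <= x 0 i, forall i, x 0 i <= x 0 b
    & sup_norm2 x <= x 0 b - x 0 a].
Proof.
move=> [_ [_ [[[a _ <-] xa] [[b _ <-] xb] ab]]].
have {}xa i : x 0 a <= x 0 i by apply: xa; exists i.
have {}xb i : x 0 i <= x 0 b by apply: xb; exists i.
exists a, b; split => //.
suff : `|x| <= x 0 b by rewrite /sup_norm2; lra.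
apply: mx_norm_le => [|i]; first by have := xa b; lra.
by rewrite ler_norml; have := xa i; have := xb i; move=> ? ?; apply/andP; split; lra.
Qed.

(** * Sign vectors of proper sets, and existence of extreme cuts *)

Lemma cut_vector_in (S : {set 'I_n}) (i : 'I_n) : i \in S -> cut_vector S 0 i = 1.
Proof. by rewrite mxE => ->. Qed.

Lemma cut_vector_notin (S : {set 'I_n}) (i : 'I_n) :
  i \notin S -> cut_vector S 0 i = -1.
Proof. by rewrite mxE => /negbTE->. Qed.

Lemma proper_setE (S : {set 'I_n}) : S <> finset.set0 /\ S <> finset.setT <->
  (exists i, i \in S) /\ (exists j, j \notin S).
Proof.
split=> [[/eqP/set0Pn Si /eqP ST]|[[i iS] [j jS]]].
  split=> //; apply: contrapT => nS; move/eqP: ST; apply; apply/setP => j.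
  by rewrite inE; apply: contrapT => jS; apply: nS; exists j; apply/negP.
split=> SE; first by rewrite SE inE in iS.
by rewrite SE inE in jS.
Qed.

Lemma balanced_cut_vector (S : {set 'I_n}) :
  S <> finset.set0 /\ S <> finset.setT -> balanced (cut_vector S).
Proof.
move=> /proper_setE[[i iS] [j jS]]; exists (-1), 1; split; last by rewrite addNr.
- split; first by exists j => //; rewrite cut_vector_notin.
  by move=> _ [k _ <-]; rewrite mxE; case: ifP => _; lra.
- split; first by exists i => //; rewrite cut_vector_in.
  by move=> _ [k _ <-]; rewrite mxE; case: ifP => _; lra.
Qed.

Lemma cut_vector_nonconst (S : {set 'I_n}) :
  S <> finset.set0 /\ S <> finset.setT -> ~ (exists c, cut_vector S = const_mx c).
Proof.
move=> /proper_setE[[i iS] [j jS]] [c cE].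
have := cut_vector_in _ _ iS; have := cut_vector_notin _ _ jS.
by rewrite cE !mxE => {cE} h1 h2; lra.
Qed.

Lemma cut_vector_neq0 (S : {set 'I_n}) : (0 < n)%N -> cut_vector S != 0.
Proof. by move=> n0; rewrite -normr_eq0 mx_norm_cut_vector ?oner_neq0. Qed.

(** Boolean form of the side condition on [S], suited to [arg_minP] and [arg_maxP]. *)
Definition proper_nonempty : pred {set 'I_n} :=
  [pred S | (S != finset.set0) && (S != finset.setT)].

Lemma ex_proper_set : (2 <= n)%N ->
  exists S : {set 'I_n}, proper_nonempty S.
Proof.
(* The witness is the singleton of vertex [0], which misses vertex [1]. *)
move=> n2; pose o := Ordinal (ltnW n2); pose p := Ordinal n2.
have /proper_setE[] :
    (exists i, i \in [set o]%SET) /\ (exists j, j \notin [set o]%SET).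
  by split; [exists o; rewrite inE | exists p; rewrite inE].
by move=> /eqP S0 /eqP ST; exists [set o]%SET; apply/andP.
Qed.

Lemma ex_min_cut : (2 <= n)%N -> exists S : {set 'I_n},
  (S <> finset.set0 /\ S <> finset.setT) /\ lbound (cut_values G) (Defs.cut G S).
Proof.
move=> /ex_proper_set[S0 pS0]; case: (arg_minP (Defs.cut G) pS0) => S /andP[/eqP ? /eqP ?] Smin.
exists S; split => // _ [T [/eqP T0 /eqP TT] <-].
by apply: Smin; apply/andP.
Qed.

Lemma ex_max_cut : (2 <= n)%N -> exists S : {set 'I_n},
  (S <> finset.set0 /\ S <> finset.setT) /\ ubound (cut_values G) (Defs.cut G S).
Proof.
move=> /ex_proper_set[S0 pS0]; case: (arg_maxP (Defs.cut G) pS0) => S /andP[/eqP ? /eqP ?] Smax.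
exists S; split => // _ [T [/eqP T0 /eqP TT] <-].
by apply: Smax; apply/andP.
Qed.

End WeightedGraph.

Theorem theorem4p1 (R : realType) (n : nat) (hn : (2 <= n)%N)
    (G : weighted_graph R n) :
  (exists lambda2 : R,
     [/\ is_min (cut_values G) lambda2,
         is_min [set rayleigh G x | x in [set x : 'rV[R]_n | x != 0 /\ balanced x]] lambda2
       & is_min (nontrivial_eigenvalues G) lambda2]) /\
  (exists lambda_max : R,
     [/\ is_max (cut_values G) lambda_max,
         is_max [set rayleigh G x | x in [set x : 'rV[R]_n | x != 0]] lambda_max
       & is_max (eigenvalues G) lambda_max]).
Proof.
have n0 : (0 < n)%N by exact: ltnW.
split.
  have [S [Sp Smin]] := ex_min_cut G hn.
  (* The sign vector of a minimum cut attains both other minima, being balanced and a nonconstant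
     eigenvector. *)
  exists (Defs.cut G S); split; split => //.
  - by exists S.
  - exists (cut_vector S); last exact: rayleigh_cut_vector.
    by split; [exact: cut_vector_neq0 | exact: balanced_cut_vector].
  - move=> _ [x [x0 /balanced_sup_norm2[a [b [xa xb xab]]]] <-].
    exact: rayleigh_ge (cut_ge0 G S) x0 xa xb xab Smin.
  - by exists (cut_vector S); split; [exact: eigenpair_cut | exact: cut_vector_nonconst].
  - move=> l [x [lx xc]]; exact: nontrivial_eigenvalue_ge n0 (cut_ge0 G S) lx xc Smin.
have [S [Sp Smax]] := ex_max_cut G hn.
exists (Defs.cut G S); split; split => //.
- by exists S.
- by exists (cut_vector S); [exact: cut_vector_neq0 | exact: rayleigh_cut_vector].
- by move=> _ [x x0 <-]; exact: rayleigh_le n0 (cut_ge0 G S) x0 Smax.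
- by exists (cut_vector S); exact: eigenpair_cut.
- move=> l [x lx]; rewrite (eigenpair_rayleigh _ _ _ lx).
  by apply: rayleigh_le n0 (cut_ge0 G S) _ Smax; case: lx.
Qed.
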